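(* Suppose $p,q\in\mathbb{C}$ with $|p|^2+|q|^2=1$. Then $$\left\{ p^{\,l_1(n)}\cdot 0^{\,l_2(n)}\cdot q^{\,l_3(n)}\, e^{2\pi i n x} : n\in\mathbb{N}_0\right\}$$ is a Parseval frame for $L^2(\mu_4)$, provided $p\neq 0$.
   Context: $\mathbb{N}_0=\{0,1,2,\dots\}$. The Cantor-4 set is $C_4=\{x\in[0,1]: x=\sum_{k=1}^\infty a_k 4^{-k},\ a_k\in\{0,2\}\}$. The measure $\mu_4$ is the uniform measure on $C_4$, i.e. the unique Borel probability measure on $\mathbb{R}$ with $\int f\,d\mu_4=\frac12\left(\int f(\frac{x}{4})\,d\mu_4(x)+\int f(\frac{x+2}{4})\,d\mu_4(x)\right)$ for all $f\in C(\mathbb{R})$; it is supported on $C_4$. $L^2(\mu_4)$ is the complex Hilbert space of square-integrable functions. For $k=1,2,3$ and $n\in\mathbb{N}_0$, $l_k(n)$ is the number of digits equal to $k$ in the base $4$ expansion of $n$ (so $l_k(0)=0$). The convention $0^0=1$ is used. A sequence $\{x_n\}_{n\in I}$ in a Hilbert space $H$ is a Parseval frame if $\sum_{n\in I}|\langle v,x_n\rangle|^2=\|v\|^2$ for all $v\in H$. *)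

(* Defs.v *)
(* Mathematical Components with MathComp-Analysis. *)
From mathcomp Require Import all_boot all_order all_algebra.
From mathcomp Require Import all_classical all_reals all_analysis.
From mathcomp.real_closed Require Export complex.
Export numFieldNormedType.Exports.

Set Implicit Arguments.
Unset Strict Implicit.
Unset Printing Implicit Defensive.

Import Order.TTheory GRing.Theory Num.Theory.
Local Open Scope classical_set_scope.
Local Open Scope ring_scope.
Local Open Scope complex_scope.
Import ComplexField.Normc.

(* Position j is read for every j < n only: since n < 4 ^ n, the digits of n at
   all later positions are 0, and they do not count because k is meant to be
   nonzero. *)
Definition ldigit (k n : nat) : nat :=
  \sum_(j < n) ((n %/ 4 ^ j) %% 4 == k)%N.

Definition expi (R : realType) (t : R) : R[i] := cos t +i* sin t.

(* The invariance equation, over all real-valued continuous f, that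
   characterizes mu_4 among the Borel probability measures on R. *)
Definition is_mu4 (R : realType) (mu : probability (measurableTypeR R) R) :
    Prop :=
  forall f : R -> R, continuous f ->
    (\int[mu]_x (f x)%:E =
      (2^-1)%:E * (\int[mu]_x (f (x / 4))%:E
                   + \int[mu]_x (f ((x + 2) / 4))%:E))%E.

Section L2.
Variables (R : realType) (mu : probability (measurableTypeR R) R).

Definition cintegral (f : R -> R[i]) : R[i] :=
  (\int[mu]_x complex.Re (f x)) +i* (\int[mu]_x complex.Im (f x)).

(* L^2(mu) is represented by the square-integrable functions themselves; the
   inner product and the norm below only depend on mu-a.e. classes. *)
Definition L2 : set (R -> R[i]) := [set f |
  [/\ measurable_fun setT ((fun x => complex.Re (f x)) : measurableTypeR R -> R),
      measurable_fun setT ((fun x => complex.Im (f x)) : measurableTypeR R -> R)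
    & (\int[mu]_x ((normc (f x)) ^+ 2)%:E < +oo)%E]].

Definition L2inner (f g : R -> R[i]) : R[i] :=
  cintegral (fun x => f x * (g x)^*).

Definition L2norm (f : R -> R[i]) : R :=
  Num.sqrt (\int[mu]_x (normc (f x)) ^+ 2).

Definition L2parseval_frame (e : nat -> R -> R[i]) : Prop :=
  (forall n, L2 (e n)) /\
  (forall v, L2 v ->
    (\sum_(0 <= n <oo) ((normc (L2inner v (e n))) ^+ 2)%:E
      = ((L2norm v) ^+ 2)%:E)%E).

End L2.

(* Main.v *)
From HB Require Import structures.
Require Import Defs.
From mathcomp Require Import all_boot all_order all_algebra.
From mathcomp Require Import all_classical all_reals all_analysis.
From mathcomp.real_closed Require Import complex.
From mathcomp Require Import measurable_realfun.
From mathcomp Require Import ring lra.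

Set Implicit Arguments.
Unset Strict Implicit.
Unset Printing Implicit Defensive.

Import Order.TTheory GRing.Theory Num.Theory.
Local Open Scope ring_scope.
Local Open Scope complex_scope.

(** Write [w_n] for the squared modulus of the weight of the n-th exponential,
    [e_t] for the exponential of real frequency [t], and [P], [Q] for the
    squared moduli of [p] and [q]. The measure is the average of its images
    under x/4 and (x+2)/4, so splitting n = 4k + d gives
    <f, e_n> = <S_d f, e_k> for the folding operator
    S_d f (x) = 1/2 e_{-d/4}(x) (f(x/4) + (-1)^d f((x+2)/4))
    ([fold4], [coef_fold4]). The weights are multiplicative along base 4
    digits, digit 2 has weight 0, and the parallelogram law gives
    |S_0 f|^2 + P |S_1 f|^2 + Q |S_3 f|^2 = |f|^2 ([sqnorm_fold4]).

    Consequently the defect of the partial sum over n < 4^N,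
    |f|^2 - sum w_n |<f, e_n>|^2, satisfies a recursion in N along S_0, S_1, S_3
    that starts from the variance of f ([defect], [defectE]). All its properties
    follow by induction from those of the variance: it is a nonnegative
    quadratic form, it is at most |f|^2 and it decreases with N. Its limit, the
    residual, is nonnegative (the Bessel inequality), and the theorem says that
    the residual is zero for every f. The residual obeys
    r(f) = r(S_0 f) + P r(S_1 f) + Q r(S_3 f) ([residual_fold4]), and this is
    used twice as a contraction.

    For frequencies t in [-1, 1], S_d e_t is a multiple of e_{(t-d)/4}, whose
    frequency is again in [-1, 1]. So r(e_t) is an average of the residuals at
    t/4, (t-1)/4 and (t-3)/4, with weights cos^2(pi t/2), P sin^2(pi t/2) and
    Q sin^2(pi t/2). From any t one of the first two branches has weight at
    least P/2 and lands in [-1/2, 1/2]; from there repeated division by 4, each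
    time with weight at least 1/2, reaches a neighbourhood of 0, where r(e_t)
    is small because e_t is close to a constant. Since P > 0 the supremum of r
    over [-1, 1] must be 0 ([residual_wave0]). When P = 0 the average at t = -1
    only sees t = -1 itself, which is why p has to be nonzero.

    For f = 1_{x < a} e_t, S_d f is half the sum of two functions of the same
    shape, cut at 4a and 4a - 2. The measure lives on an interval of length less
    than 2, so one of the two cuts is invisible and the corresponding summand
    has residual 0. Halving divides residuals by 4, and this beats the factor
    3/2 lost in the subadditivity inequality and the total weight 1 + P + Q = 2;
    iterating gives residual 0 ([residual_ray]). The functions of residual 0
    form a linear space closed under dominated limits; containing the indicators
    of half-lines, it contains those of all Borel sets by Dynkin's theorem,
    hence all of L^2 ([residual_L2]). *)

(** * Self-similarity and support of the measure *)

Section invariance.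
Local Open Scope classical_set_scope.
Variables (R : realType) (mu : probability (measurableTypeR R) R).
Local Notation T := (measurableTypeR R).

(** Continuous approximations of the indicator of a half-line: they carry the
    invariance equation, given for continuous functions, over to sets. *)
Definition ramp (a : R) (n : nat) (x : R) : R :=
  Num.min 1 (Num.max 0 (n%:R * (a - x))).

Lemma continuous_ramp a n : continuous (ramp a n).
Proof.
have h : continuous (fun x : R => n%:R * (a - x)).
  move=> x; apply: cvgM; first exact: cvg_cst.
  by apply: cvgB; [exact: cvg_cst|exact: cvg_id].
move=> x.
apply: (@continuous_min R R (cst 1) (cst 0 \max (fun y => n%:R * (a - y)))).
  exact: cst_continuous.
by apply: continuous_max; [exact: cst_continuous|exact: h].
Qed.

Lemma ramp_bound a n x : `|ramp a n x| <= 1.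
Proof. by rewrite /ramp ger0_norm ?ge_min ?lexx// le_min ler01 le_max lexx. Qed.

Lemma ramp_cvg a x : ramp a n x @[n --> \oo] --> (\1_(`]-oo, a[) x : R).
Proof.
rewrite indicE mem_setE in_itv/=; case: ltP => [xa|ax].
  apply: cvg_near_cst; near=> n; apply: min_l.
  rewrite le_max; apply/orP; right; rewrite -ler_pdivrMr ?subr_gt0//.
  by near: n; exact: nbhs_infty_ger.
apply: cvg_near_cst; apply: nearW => n.
by rewrite /ramp max_l ?min_r// mulr_ge0_le0// subr_le0.
Unshelve. all: by end_near. Qed.

Lemma ramp_integral_cvg a (g : T -> R) : measurable_fun setT g ->
  (\int[mu]_x (ramp a n (g x))%:E @[n --> \oo] --> mu (g @^-1` `]-oo, a[))%E.
Proof.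
move=> mg.
have mA : measurable (g @^-1` `]-oo, a[).
  by rewrite -[X in measurable X]setTI; exact: mg.
have mr n : measurable_fun setT (fun x : T => ramp a n (g x)).
  apply: (measurableT_comp _ mg); apply: continuous_measurable_fun.
  exact: continuous_ramp.
have -> : mu (g @^-1` `]-oo, a[) = (\int[mu]_x (\1_(`]-oo, a[) (g x))%:E)%E.
  rewrite -[g @^-1` _]setIT -integral_indic//.
have [|||||_ _] := @dominated_convergence _ T R mu setT measurableT
  (fun n x => (ramp a n (g x))%:E) (fun x => (\1_(`]-oo, a[) (g x))%:E)
  (EFin \o cst 1).
- by move=> n; apply/measurable_EFinP.
- apply/measurable_EFinP; apply: (measurableT_comp _ mg) => //.
- by apply: aeW => x _; apply: cvg_EFin; [exact: nearW|exact: ramp_cvg].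
- exact: finite_measure_integrable_cst.
- by apply: aeW => x n _; rewrite lee_fin ramp_bound.
- by [].
Qed.

Hypothesis hmu : is_mu4 mu.

Definition left_branch (x : T) : T := (x : R) / 4.
Definition right_branch (x : T) : T := ((x : R) + 2) / 4.

Lemma measurable_left_branch : measurable_fun setT left_branch.
Proof. exact: (@measurable_funM _ T R setT id (cst 4^-1)). Qed.

Lemma measurable_right_branch : measurable_fun setT right_branch.
Proof.
apply: (@measurable_funM _ T R setT (fun x => x + 2) (cst 4^-1)) => //.
exact: (@measurable_funD _ T R setT id (cst 2)).
Qed.

HB.instance Definition _ :=
  isMeasurableFun.Build _ _ T T left_branch measurable_left_branch.
HB.instance Definition _ :=
  isMeasurableFun.Build _ _ T T right_branch measurable_right_branch.

Lemma mu4_ray a : (mu `]-oo, a[ + mu `]-oo, a[ =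
  mu (left_branch @^-1` `]-oo, a[) + mu (right_branch @^-1` `]-oo, a[))%E.
Proof.
have mA (g : T -> T) : measurable_fun setT g ->
    mu (g @^-1` `]-oo, a[) \is a fin_num.
  move=> mg; apply: fin_num_measure.
  by rewrite -[X in measurable X]setTI; exact: mg.
have c g (mg : measurable_fun setT g) := @ramp_integral_cvg a g mg.
have cL := cvgeD (fin_num_adde_defl _ (mA _ (@measurable_id _ _ _)))
  (c _ (@measurable_id _ _ _)) (c _ (@measurable_id _ _ _)).
have cR := cvgeD (fin_num_adde_defl _ (mA _ measurable_right_branch))
  (c _ measurable_left_branch) (c _ measurable_right_branch).
have {cL} <- := cvg_lim (@ereal_hausdorff R) (cL _).
have {cR} <- := cvg_lim (@ereal_hausdorff R) (cR _).
apply: congr_lim; apply/funext => n /=.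
rewrite hmu; last exact: continuous_ramp.
by rewrite -ge0_muleDl// -EFinD -div1r -splitr mul1e.
Qed.

Let measure_add_apply (m1 m2 : {measure set T -> \bar R}) A :
  measure_add m1 m2 A = (m1 A + m2 A)%E.
Proof. by rewrite measure_addE. Qed.

(** Both sides are measures of total mass 2, so it is enough that they agree on
    the half-lines, a generating class stable under intersection. *)
Lemma mu4_measure (A : set T) : measurable A ->
  (mu A + mu A = mu (left_branch @^-1` A) + mu (right_branch @^-1` A))%E.
Proof.
move=> mA.
pose nu := measure_add (distribution mu left_branch) (distribution mu right_branch).
rewrite -(measure_add_apply mu mu) -[RHS](measure_add_apply
  (distribution mu left_branch) (distribution mu right_branch)).
pose g (n : nat) : set T := `]-oo, n%:R[.
apply: (@g_sigma_algebra_measure_unique _ R T (@RGenInftyO.G R) _ g _ _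
  (measure_add mu mu) nu) => //.
- by move=> _ [x ->]; exact: measurable_itv.
- by move=> n; exists n%:R.
- apply/seteqP; split => // x _; exists (Num.bound `|x|) => //=.
  rewrite /g/= in_itv/=.
  by apply: le_lt_trans (ler_norm x) _; exact: archi_boundP.
- move=> _ _ [x ->] [y ->]; exists (Num.min x y).
  by apply/seteqP; split => z /=; rewrite !in_itv/= lt_min => /andP.
- move=> _ [a ->]; rewrite [LHS]measure_add_apply [RHS]measure_add_apply.
  exact: mu4_ray.
- move=> k; have mk : mu (g k) \is a fin_num.
    by apply: fin_num_measure; exact: measurable_itv.
  by rewrite [ltLHS]measure_add_apply -ge0_fin_numE ?adde_ge0// fin_numD mk.
- change ((RGenInftyO.G (R:=R)).-sigma.-measurable A).
  by rewrite -RGenInftyO.measurableE.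
Qed.

Lemma mu4_ge0_integral (f : T -> R) : measurable_fun setT f ->
  (forall x, 0 <= f x) ->
  (\int[mu]_x (f x)%:E + \int[mu]_x (f x)%:E =
   \int[mu]_x (f (left_branch x))%:E + \int[mu]_x (f (right_branch x))%:E)%E.
Proof.
move=> mf f0.
have mE : measurable_fun setT (EFin \o f) by exact/measurable_EFinP.
have f0E (x : T) : (0 <= (f x)%:E)%E by rewrite lee_fin.
transitivity (\int[measure_add mu mu]_x (f x)%:E)%E.
  by rewrite ge0_integral_measure_add.
transitivity (\int[measure_add (distribution mu left_branch)
    (distribution mu right_branch)]_x (f x)%:E)%E.
  apply: eq_measure_integral => A mA _.
  rewrite [LHS]measure_add_apply [RHS]measure_add_apply; exact: mu4_measure.
by rewrite ge0_integral_measure_add// !ge0_integral_distribution.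
Qed.

Lemma mu4_integrable (f : T -> R) : mu.-integrable setT (EFin \o f) ->
  mu.-integrable setT (EFin \o (f \o left_branch)) /\
  mu.-integrable setT (EFin \o (f \o right_branch)).
Proof.
move=> intf; have /measurable_EFinP mf := measurable_int mu intf.
have mn : measurable_fun setT (fun x : T => `|f x|).
  by apply: measurableT_comp => //; exact: normr_measurable.
have := mu4_ge0_integral mn (fun _ => normr_ge0 _).
move/integrableP : intf => [_] /= intf S.
have : (\int[mu]_x `|f (left_branch x)|%:E
        + \int[mu]_x `|f (right_branch x)|%:E < +oo)%E.
  by rewrite -S lte_add_pinfty.
have I0 : (0 <= \int[mu]_x `|f (left_branch x)|%:E)%E by exact: integral_ge0.
have I1 : (0 <= \int[mu]_x `|f (right_branch x)|%:E)%E by exact: integral_ge0.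
move=> fin; split; apply/integrableP; split.
- by apply/measurable_EFinP; apply: measurableT_comp.
- by apply: le_lt_trans fin; exact: leeDl.
- by apply/measurable_EFinP; apply: measurableT_comp.
- by apply: le_lt_trans fin; exact: leeDr.
Qed.

Lemma mu4_Rintegral (f : T -> R) : mu.-integrable setT (EFin \o f) ->
  \int[mu]_x f x =
  2^-1 * (\int[mu]_x f (left_branch x) + \int[mu]_x f (right_branch x)).
Proof.
move=> intf; have /measurable_EFinP mf := measurable_int mu intf.
have [i0 i1] := mu4_integrable intf.
pose fp := f^\+%R; pose fn := f^\-%R.
have ip : mu.-integrable setT (EFin \o fp) by exact: integrable_funrpos.
have in_ : mu.-integrable setT (EFin \o fn) by exact: integrable_funrneg.
have G g : mu.-integrable setT (EFin \o g) -> (forall x, 0 <= g x) ->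
    \int[mu]_x g x =
    2^-1 * (\int[mu]_x g (left_branch x) + \int[mu]_x g (right_branch x)).
  move=> ig g0; have [ig0 ig1] := mu4_integrable ig.
  have /measurable_EFinP mg := measurable_int mu ig.
  have S : \int[mu]_x g x + \int[mu]_x g x =
      \int[mu]_x g (left_branch x) + \int[mu]_x g (right_branch x).
    rewrite -[LHS]fineD ?integrable_fin_num// -[RHS]fineD ?integrable_fin_num//.
    by rewrite mu4_ge0_integral.
  by rewrite -S; field.
have D h : (fun x => f (h x)) = (fun x => fp (h x) - fn (h x)) :> (T -> R).
  by apply/funext => x; rewrite -[f in LHS]funrposBneg.
have [ip0 ip1] := mu4_integrable ip; have [in0 in1] := mu4_integrable in_.
rewrite (_ : f = (fun x => fp x - fn x)); last exact: (D id).
rewrite /= !RintegralB// (G fp ip (funrpos_ge0 f)) (G fn in_ (funrneg_ge0 f)).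
by ring.
Qed.

(** The convex hull of the Cantor set is [0, 2/3], the interval of centre 1/3
    and radius 1/3; [far c] is the complement of the interval of radius c. *)
Definition far (c : R) : set T := [set x : T | c < `|(x : R) - 3^-1|].

Lemma measurable_far c : measurable (far c).
Proof.
have mf : measurable_fun setT (fun x : T => `|(x : R) - 3^-1|).
  apply: measurableT_comp; first exact: normr_measurable.
  exact: (@measurable_funB _ T R setT id (cst 3^-1)).
have -> : far c = (fun x : T => `|(x : R) - 3^-1|) @^-1` `]c, +oo[.
  by apply/seteqP; split => x; rewrite /= in_itv/= andbT.
by rewrite -[X in measurable X]setTI; exact: mf.
Qed.

(** Both branches move the distance y to the centre to at most y/4 + 1/4, so the
    preimages of [far c] lie in [far (4 * c - 1)], hence in [far (2 * c)]. *)
Lemma far_doubling c : 2^-1 <= c -> (mu (far c) <= mu (far (2 * c)))%E.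
Proof.
move=> c2.
have S0 : (mu (left_branch @^-1` far c) <= mu (far (2 * c)))%E.
  apply: le_measure; rewrite ?inE; last 1 first.
  - move=> x; rewrite /far /left_branch /=; apply: contraLR.
    by rewrite -!leNgt !ler_norml => /andP[? ?]; apply/andP; split; lra.
  - rewrite -[X in measurable X]setTI; apply: measurable_left_branch => //.
    exact: measurable_far.
  - exact: measurable_far.
have S1 : (mu (right_branch @^-1` far c) <= mu (far (2 * c)))%E.
  apply: le_measure; rewrite ?inE; last 1 first.
  - move=> x; rewrite /far /right_branch /=; apply: contraLR.
    by rewrite -!leNgt !ler_norml => /andP[? ?]; apply/andP; split; lra.
  - rewrite -[X in measurable X]setTI; apply: measurable_right_branch => //.
    exact: measurable_far.
  - exact: measurable_far.
have := leeD S0 S1; rewrite -mu4_measure; last exact: measurable_far.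
have F A : measurable A -> mu A = (fine (mu A))%:E.
  by move=> mA; rewrite fineK// fin_num_measure.
rewrite (F (far c)); last exact: measurable_far.
rewrite (F (far (2 * c))); last exact: measurable_far.
by rewrite -!EFinD !lee_fin; lra.
Qed.

(** The measure of [far c] at c = 1/2 is at most that of [far c] at c = 2^n / 2,
    and these sets decrease to the empty set. *)
Lemma mu4_far : mu (far 2^-1) = 0%E.
Proof.
pose F n := far (2^-1 * 2 ^+ n).
have Fle n : (mu (far 2^-1) <= mu (F n))%E.
  elim: n => [|n IH]; first by rewrite /F expr0 mulr1.
  apply: (le_trans IH); rewrite /F exprS mulrCA; apply: far_doubling.
  by rewrite ler_peMr// exprn_ege1// ler1n.
have : mu (F n) @[n --> \oo] --> mu (\bigcap_n F n).
  apply: nonincreasing_cvg_mu => //.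
  - by rewrite ltey_eq fin_num_measure//; exact: measurable_far.
  - by move=> n; exact: measurable_far.
  - by apply: bigcapT_measurable => n; exact: measurable_far.
  - apply/nonincreasing_seqP => n; apply/subsetPset => x; rewrite /F /far /=.
    apply: le_lt_trans; rewrite ler_pM2l ?invr_gt0//.
    by rewrite exprS ler_peMl// ?exprn_ge0// ler1n.
have -> : \bigcap_n F n = set0.
  rewrite -subset0 => x h.
  pose y := `|(x : R) - 3^-1|.
  have /= := h (Num.bound (2 * y)) Logic.I.
  rewrite /F /far /= -/y ltNge => /negP; apply.
  rewrite -(ler_pM2l (ltr0n _ 2)) mulrA divff// mul1r.
  apply: (le_trans (ltW (archi_boundP _))); first by rewrite mulr_ge0 ?normr_ge0.
  by rewrite -natrX ler_nat ltnW// ltn_expl.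
rewrite measure0 => cF; apply/eqP; rewrite eq_le measure_ge0 andbT.
by apply: (cvge_ge _ cF); apply: nearW => n; exact: Fle.
Qed.

End invariance.

(** * Squared modulus and complex exponentials *)

Section complex_facts.
Variable R : realType.
Implicit Types (z w c : R[i]) (s t : R).

Definition nsq z : R := complex.Re z ^+ 2 + complex.Im z ^+ 2.

Lemma nsqE z : ComplexField.Normc.normc z ^+ 2 = nsq z.
Proof. by case: z => a b; rewrite /nsq /= sqr_sqrtr// addr_ge0// sqr_ge0. Qed.

Lemma nsq_ge0 z : 0 <= nsq z.
Proof. by rewrite addr_ge0// sqr_ge0. Qed.

Lemma nsqM z w : nsq (z * w) = nsq z * nsq w.
Proof. by rewrite -!nsqE ComplexField.Normc.normcM exprMn. Qed.

Lemma nsqX z n : nsq (z ^+ n) = nsq z ^+ n.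
Proof.
elim: n => [|n IH]; first by rewrite !expr0 /nsq /= expr1n expr0n addr0.
by rewrite !exprS nsqM IH.
Qed.

Lemma nsq_conj z : nsq z^* = nsq z.
Proof. by case: z => a b; rewrite /nsq /= sqrrN. Qed.

Lemma nsqN z : nsq (- z) = nsq z.
Proof. by case: z => a b; rewrite /nsq /= !sqrrN. Qed.

Lemma nsq0 : nsq 0 = 0.
Proof. by rewrite /nsq /= expr0n addr0. Qed.

Lemma nsq_parallelogram z w : nsq (z + w) + nsq (z - w) = 2 * (nsq z + nsq w).
Proof. by case: z w => a b [c d]; rewrite /nsq /=; ring. Qed.

(** A form of the triangle inequality without square roots. The coefficient
    3/2 < 2 of the second term is what makes the later contraction work. *)
Lemma nsqD_le z w : nsq (z + w) <= 3 * nsq z + 3 / 2 * nsq w.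
Proof. 
case: z w => a b [c d]; rewrite /nsq /=.
have := sqr_ge0 (2 * a - c); have := sqr_ge0 (2 * b - d); nra.
Qed.

Lemma nsq_expi t : nsq (expi t) = 1.
Proof. by rewrite /nsq /= cos2Dsin2. Qed.

Lemma expi0 : expi (0 : R) = 1.
Proof. by rewrite /expi cos0 sin0. Qed.

Lemma expiD s t : expi (s + t) = expi s * expi t.
Proof.
apply/eqP; rewrite eq_complex /= cosD sinD eqxx/=; apply/eqP; ring.
Qed.

Lemma conj_expi t : (expi t)^* = expi (- t).
Proof. by rewrite /expi /= cosN sinN. Qed.

Lemma expi_pi_nat n : expi (pi *+ n : R) = (-1) ^+ n.
Proof.
elim: n => [|n IH]; first by rewrite mulr0n expi0.
rewrite mulrS expiD IH exprS /expi cospi sinpi.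
by congr (_ * _); apply/eqP; rewrite eq_complex /= oppr0 !eqxx.
Qed.

End complex_facts.

(** * Square-integrable complex functions *)

Section complex_integration.
Local Open Scope classical_set_scope.
Variables (R : realType) (mu : probability (measurableTypeR R) R).
Local Notation T := (measurableTypeR R).
Local Notation C := R[i].
Implicit Types (f g : R -> C).

Lemma integrableZ_EFin (k : R) (h : T -> R) :
  mu.-integrable setT (EFin \o h) ->
  mu.-integrable setT (EFin \o ((fun x => k * h x) : T -> R)).
Proof. exact: (@integrableZl _ _ _ mu setT measurableT k (EFin \o h)). Qed.

Lemma integrableD_EFin (g h : T -> R) :
  mu.-integrable setT (EFin \o g) -> mu.-integrable setT (EFin \o h) ->
  mu.-integrable setT (EFin \o ((fun x => g x + h x) : T -> R)).
Proof. exact: (@integrableD _ _ _ mu setT measurableT (EFin \o g) (EFin \o h)). Qed.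

Lemma integrable_cst_EFin (k : R) :
  mu.-integrable setT (EFin \o ((fun=> k) : T -> R)).
Proof. exact: finite_measure_integrable_cst. Qed.

Definition cmeasurable f :=
  measurable_fun setT ((fun x => complex.Re (f x)) : T -> R) /\
  measurable_fun setT ((fun x => complex.Im (f x)) : T -> R).

Definition cintegrable f :=
  mu.-integrable setT (EFin \o ((fun x => complex.Re (f x)) : T -> R)) /\
  mu.-integrable setT (EFin \o ((fun x => complex.Im (f x)) : T -> R)).

Definition sqnorm f : R := \int[mu]_x nsq (f x).

Lemma cmeasurableD f g : cmeasurable f -> cmeasurable g ->
  cmeasurable (fun x => f x + g x).
Proof.
move=> [rf If] [rg Ig]; split.
  rewrite (_ : (fun x => _) = (fun x => complex.Re (f x) + complex.Re (g x))).
    exact: measurable_funD.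
  by apply/funext => x; case: (f x) (g x) => a b [c d].
rewrite (_ : (fun x => _) = (fun x => complex.Im (f x) + complex.Im (g x))).
  exact: measurable_funD.
by apply/funext => x; case: (f x) (g x) => a b [c d].
Qed.

Lemma cmeasurableM f g : cmeasurable f -> cmeasurable g ->
  cmeasurable (fun x => f x * g x).
Proof.
move=> [rf If] [rg Ig]; split.
  rewrite (_ : (fun x => _) = (fun x => complex.Re (f x) * complex.Re (g x)
                               - complex.Im (f x) * complex.Im (g x))).
    by apply: measurable_funB; exact: measurable_funM.
  by apply/funext => x; case: (f x) (g x) => a b [c d].
rewrite (_ : (fun x => _) = (fun x => complex.Re (f x) * complex.Im (g x)
                               + complex.Im (f x) * complex.Re (g x))).
  by apply: measurable_funD; exact: measurable_funM.
by apply/funext => x; case: (f x) (g x) => a b [c d].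
Qed.

Lemma cmeasurable_cst (c : C) : cmeasurable (fun=> c).
Proof. by split; exact: measurable_cst. Qed.

Lemma measurable_nsq f : cmeasurable f ->
  measurable_fun setT ((fun x => nsq (f x)) : T -> R).
Proof. by move=> [? ?]; apply: measurable_funD; exact: measurable_funX. Qed.

Lemma L2P f : L2 mu f <->
  cmeasurable f /\ mu.-integrable setT (EFin \o ((fun x => nsq (f x)) : T -> R)).
Proof.
have E : (\int[mu]_x (ComplexField.Normc.normc (f x) ^+ 2)%:E =
          \int[mu]_x `|(nsq (f x))%:E|)%E.
  by apply: eq_integral => x _; rewrite nsqE abse_EFin ger0_norm// nsq_ge0.
split=> [[mr mi fin]|[mf /integrableP[_ fin]]].
  split => //; apply/integrableP; split; last by rewrite -E.
  by apply/measurable_EFinP; exact: measurable_nsq.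
by case: mf => mr mi; split => //; rewrite E.
Qed.

Lemma le_L2 f (g : R -> R) : cmeasurable f ->
  mu.-integrable setT (EFin \o (g : T -> R)) ->
  (forall x, nsq (f x) <= g x) -> L2 mu f.
Proof.
move=> mf ig fg; apply/L2P; split => //.
apply: le_integrable ig => //.
  by apply/measurable_EFinP; exact: measurable_nsq.
move=> x _; rewrite !abse_EFin lee_fin ger0_norm ?nsq_ge0//.
by apply: le_trans (fg x) _; exact: ler_norm.
Qed.

Lemma L2_bounded f (M : R) : cmeasurable f -> (forall x, nsq (f x) <= M) ->
  L2 mu f.
Proof.
by move=> mf fM; apply: (le_L2 mf _ fM); exact: integrable_cst_EFin.
Qed.

Lemma L2_cst (c : C) : L2 mu (fun=> c).
Proof. by apply: (@L2_bounded _ (nsq c)) => //; exact: cmeasurable_cst. Qed.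

Lemma L2D f g : L2 mu f -> L2 mu g -> L2 mu (fun x => f x + g x).
Proof.
move=> /L2P[mf nf] /L2P[mg ng].
apply: (@le_L2 _ (fun x => 3 * nsq (f x) + 3 / 2 * nsq (g x))).
- exact: cmeasurableD.
- by apply: integrableD_EFin; exact: integrableZ_EFin.
- by move=> x; exact: nsqD_le.
Qed.

Lemma L2M_bounded f g (M : R) : L2 mu f -> cmeasurable g ->
  (forall x, nsq (g x) <= M) -> L2 mu (fun x => f x * g x).
Proof.
move=> /L2P[mf nf] mg gM.
apply: (@le_L2 _ (fun x => M * nsq (f x))); first exact: cmeasurableM.
  exact: integrableZ_EFin.
by move=> x; rewrite nsqM mulrC ler_wpM2r// nsq_ge0.
Qed.

Lemma L2Z c f : L2 mu f -> L2 mu (fun x => c * f x).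
Proof.
move=> Lf; rewrite (_ : (fun x => _) = (fun x => f x * c)).
  by apply: (@L2M_bounded _ _ (nsq c)) => //; exact: cmeasurable_cst.
by apply/funext => x; rewrite mulrC.
Qed.

Lemma L2_cintegrable f : L2 mu f -> cintegrable f.
Proof.
move=> /L2P[[mr mi] nf].
have i1 : mu.-integrable setT (EFin \o ((fun x => 1 + nsq (f x)) : T -> R)).
  by apply: integrableD_EFin => //; exact: integrable_cst_EFin.
have B (u v : R) : `|u| <= `|1 + (u ^+ 2 + v ^+ 2)|.
  rewrite [leRHS]ger0_norm; last by rewrite !addr_ge0// sqr_ge0.
  have := sqr_ge0 (`|u| - 2^-1); rewrite sqrrB real_normK ?num_real//.
  have := sqr_ge0 v; lra.
split; apply: le_integrable i1 => //; try exact/measurable_EFinP.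
- by move=> x _; rewrite !abse_EFin lee_fin; exact: B.
- by move=> x _; rewrite !abse_EFin lee_fin /nsq [_ ^+ 2 + _]addrC; exact: B.
Qed.

Lemma cintegralD f g : cintegrable f -> cintegrable g ->
  cintegral mu (fun x => f x + g x) = cintegral mu f + cintegral mu g.
Proof.
move=> [rf If] [rg Ig]; rewrite /cintegral; apply/eqP; rewrite eq_complex /=.
rewrite -!RintegralD//; apply/andP; split; apply/eqP; apply: eq_Rintegral => x _;
  by case: (f x) (g x) => a b [c d].
Qed.

Lemma cintegralZ c f : cintegrable f ->
  cintegral mu (fun x => c * f x) = c * cintegral mu f.
Proof.
move=> [rf If]; case: c => a b; apply/eqP; rewrite eq_complex /=.
apply/andP; split; apply/eqP.
  rewrite -!(RintegralZl _ measurableT)// -RintegralB//; try exact: integrableZ_EFin.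
  by apply: eq_Rintegral => x _; case: (f x).
rewrite -!(RintegralZl _ measurableT)// -RintegralD//; try exact: integrableZ_EFin.
by apply: eq_Rintegral => x _; case: (f x).
Qed.

Lemma sqnorm_ge0 f : 0 <= sqnorm f.
Proof. by apply: Rintegral_ge0 => x _; exact: nsq_ge0. Qed.

Lemma sqnormM c f : L2 mu f -> sqnorm (fun x => c * f x) = nsq c * sqnorm f.
Proof.
move=> /L2P[mf nf]; rewrite /sqnorm -RintegralZl//.
by apply: eq_Rintegral => x _; exact: nsqM.
Qed.

Lemma sqnormD_le f g : L2 mu f -> L2 mu g ->
  sqnorm (fun x => f x + g x) <= 3 * sqnorm f + 3 / 2 * sqnorm g.
Proof.
move=> Lf Lg; move: (Lf) (Lg) => /L2P[mf nf] /L2P[mg ng].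
have /L2P[_ nfg] := L2D Lf Lg.
rewrite /sqnorm -!(RintegralZl _ measurableT)// -RintegralD//;
  try exact: integrableZ_EFin.
apply: le_Rintegral => //; last by move=> x _; exact: nsqD_le.
by apply: integrableD_EFin; exact: integrableZ_EFin.
Qed.

Lemma sqnorm_L2norm f : L2norm mu f ^+ 2 = sqnorm f.
Proof.
rewrite /L2norm; under eq_Rintegral do rewrite nsqE.
by rewrite sqr_sqrtr// sqnorm_ge0.
Qed.

(** The variance of f. It is also what remains of the squared norm after the
    single frequency 0 has been taken into account. *)
Definition cvar f : R := sqnorm f - nsq (cintegral mu f).

(** Writing the variance as a squared norm makes it visibly nonnegative and gives
    it the subadditivity of [sqnormD_le]. *)
Lemma cvarE f : L2 mu f -> cvar f = sqnorm (fun x => f x + - cintegral mu f).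
Proof.
move=> Lf; move: (Lf) => /L2P[mf nf]; have [ir ii] := L2_cintegrable Lf.
rewrite /cvar; set c := cintegral mu f.
rewrite [in RHS]/sqnorm.
transitivity (\int[mu]_x (nsq (f x) + (-2 * complex.Re c * complex.Re (f x)
   + (-2 * complex.Im c * complex.Im (f x) + nsq c)))).
  have iZ := integrableZ_EFin; have iD := integrableD_EFin.
  have ic := integrable_cst_EFin.
  have i1 := iD _ _ (iZ (-2 * complex.Im c) _ ii) (ic (nsq c)).
  have i2 := iD _ _ (iZ (-2 * complex.Re c) _ ir) i1.
  rewrite (RintegralD _ nf i2)// (RintegralD _ (iZ _ _ ir) i1)//.
  rewrite (RintegralD _ (iZ _ _ ii) (ic _))// !(RintegralZl _ measurableT)//.
  rewrite Rintegral_cst//= probability_setT mulr1 -/(sqnorm f).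
  rewrite -[\int[mu]_x complex.Re (f x)]/(complex.Re c).
  rewrite -[\int[mu]_x complex.Im (f x)]/(complex.Im c) /nsq; ring.
apply: eq_Rintegral => x _; case: (f x) c => a b [d e]; rewrite /nsq /=; ring.
Qed.

Lemma cvar_ge0 f : L2 mu f -> 0 <= cvar f.
Proof. by move=> Lf; rewrite cvarE// sqnorm_ge0. Qed.

Lemma cvar_le f : cvar f <= sqnorm f.
Proof. by rewrite /cvar gerBl nsq_ge0. Qed.

Lemma cvarD_le f g : L2 mu f -> L2 mu g ->
  cvar (fun x => f x + g x) <= 3 * cvar f + 3 / 2 * cvar g.
Proof.
move=> Lf Lg; rewrite !cvarE//; last exact: L2D.
rewrite cintegralD//; [|exact: L2_cintegrable..].
apply: le_trans (sqnormD_le (L2D Lf (L2_cst _)) (L2D Lg (L2_cst _))).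
rewrite le_eqVlt; apply/orP; left; apply/eqP; congr sqnorm; apply/funext => x.
by ring.
Qed.

Lemma cvarM c f : L2 mu f -> cvar (fun x => c * f x) = nsq c * cvar f.
Proof.
move=> Lf; rewrite /cvar sqnormM// cintegralZ; last exact: L2_cintegrable.
by rewrite nsqM mulrBr.
Qed.

End complex_integration.

(** * Folding operators *)

Section transfer.
Local Open Scope classical_set_scope.
Variables (R : realType) (mu : probability (measurableTypeR R) R).
Hypothesis hmu : is_mu4 mu.
Local Notation T := (measurableTypeR R).
Local Notation C := R[i].
Implicit Types (f g : R -> C).

Definition wave (t : R) (x : R) : C := expi (2 * pi * t * x).

Lemma cmeasurable_wave t : cmeasurable (wave t).
Proof.
have mt : measurable_fun setT ((fun x => 2 * pi * t * x) : T -> R).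
  exact: (@measurable_funM _ T R setT (cst _) id).
by split; apply: measurableT_comp mt; apply: continuous_measurable_fun;
  [exact: continuous_cos|exact: continuous_sin].
Qed.

Lemma L2_wave t : L2 mu (wave t).
Proof.
apply: (@L2_bounded _ _ _ 1); first exact: cmeasurable_wave.
by move=> x; rewrite nsq_expi.
Qed.

Lemma L2_comp_branch f : L2 mu f ->
  L2 mu (f \o @left_branch R) /\ L2 mu (f \o @right_branch R).
Proof.
move=> /L2P[[mr mi] nf]; have [n0 n1] := mu4_integrable hmu nf.
split; apply/L2P; split=> //; split.
- exact: (measurableT_comp mr (@measurable_left_branch R)).
- exact: (measurableT_comp mi (@measurable_left_branch R)).
- exact: (measurableT_comp mr (@measurable_right_branch R)).
- exact: (measurableT_comp mi (@measurable_right_branch R)).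
Qed.

Lemma mu4_cintegral f : cintegrable mu f ->
  cintegral mu f = 2^-1 *
    (cintegral mu (f \o @left_branch R) + cintegral mu (f \o @right_branch R)).
Proof.
move=> [ir ii]; rewrite [in LHS]/cintegral.
rewrite (mu4_Rintegral hmu ir) (mu4_Rintegral hmu ii).
have -> : 2^-1 = (2^-1)%:C :> C by rewrite fmorphV rmorph_nat.
by rewrite /cintegral; apply/eqP; rewrite eq_complex /= !mul0r subr0 addr0 !eqxx.
Qed.

(** The average of f times the conjugate of e_d over the two branches, that is,
    over the preimages of x under 4 x modulo 2; at the right branch e_d has picked
    up the sign (-1)^d. *)
Definition fold4 (d : nat) f : R -> C := fun x =>
  2^-1 * (f (left_branch x) + (-1) ^+ d * f (right_branch x))
    * wave (- (d%:R / 4)) x.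

Lemma L2_fold4 d f : L2 mu f -> L2 mu (fold4 d f).
Proof.
move=> Lf; have [L0 L1] := L2_comp_branch Lf.
apply: (@L2M_bounded _ _ _ _ 1); last by move=> x; rewrite nsq_expi.
- by apply: L2Z; apply: L2D => //; exact: L2Z.
- exact: cmeasurable_wave.
Qed.

Lemma fold4D d f g x : fold4 d (fun x => f x + g x) x = fold4 d f x + fold4 d g x.
Proof. by rewrite /fold4; ring. Qed.

Lemma fold4Z d c f x : fold4 d (fun x => c * f x) x = c * fold4 d f x.
Proof. by rewrite /fold4; ring. Qed.

Definition coef f (t : R) : C := L2inner mu f (wave t).

Lemma conj_wave t x : Num.conj (wave t x) = wave (- t) x.
Proof.
by rewrite -[LHS]/(conjc _) /wave conj_expi; congr expi; ring.
Qed.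

Lemma L2_mul_wave f t : L2 mu f -> L2 mu (fun x => f x * (wave t x)^*).
Proof.
move=> Lf.
have -> : (fun x => f x * (wave t x)^*) = (fun x => f x * wave (- t) x).
  by apply/funext => x; rewrite conj_wave.
apply: (@L2M_bounded _ _ _ _ 1) => //; first exact: cmeasurable_wave.
by move=> x; rewrite nsq_expi.
Qed.

Lemma wave_left_branch t x : wave t (left_branch x) = wave (t / 4) x.
Proof. by rewrite /wave /left_branch; congr expi; field. Qed.

Lemma wave_right_branch t x :
  wave t (right_branch x) = expi (pi * t) * wave (t / 4) x.
Proof. by rewrite /wave /right_branch -expiD; congr expi; field. Qed.

Lemma waveD s t x : wave (s + t) x = wave s x * wave t x.
Proof. by rewrite /wave -expiD; congr expi; ring. Qed.

Lemma expi_piN n : expi (pi * - n%:R : R) = (-1) ^+ n.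
Proof.
rewrite mulrN mulr_natr.
rewrite -[LHS]mulr1 -[X in _ * X = _](sqrr_sign _ n) expr2 mulrA.
rewrite -[X in _ * X * _]expi_pi_nat.
by rewrite -expiD addNr expi0 mul1r.
Qed.

(** The exponential e_{4k+d} at the two branches only differs by the sign
    (-1)^d, since e_{4k} is invariant under the translation by 1/2. *)
Lemma coef_fold4 f d k : L2 mu f ->
  coef f (4 * k + d)%:R = coef (fold4 d f) k%:R.
Proof.
move=> Lf; rewrite /coef /L2inner.
have Lh := L2_mul_wave (4 * k + d)%:R Lf.
have [L0 L1] := L2_comp_branch Lh.
rewrite mu4_cintegral; last exact: L2_cintegrable.
rewrite -cintegralD; [|exact: L2_cintegrable..].
rewrite -cintegralZ; last exact: (L2_cintegrable (L2D L0 L1)).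
congr cintegral; apply/funext => x /=.
rewrite !conj_wave wave_left_branch wave_right_branch expi_piN /fold4.
have -> : (-1) ^+ (4 * k + d) = (-1) ^+ d :> C.
  by rewrite exprD exprM -[(-1) ^+ 4]signr_odd expr0 expr1n mul1r.
have -> : - (4 * k + d)%:R / 4 = - (d%:R / 4) + - k%:R :> R.
  by rewrite natrD natrM; field.
by rewrite waveD; ring.
Qed.

Lemma cintegral_fold4_0 f : L2 mu f -> cintegral mu (fold4 0 f) = cintegral mu f.
Proof.
move=> Lf; have := @coef_fold4 f 0 0 Lf; rewrite /coef /L2inner => E.
have W x : wave (0 : R) x = 1 by rewrite /wave mulr0 mul0r expi0.
have H h : (fun x => h x * (wave (0 : R) x)^*) = h.
  by apply/funext => x; rewrite W rmorph1 mulr1.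
by move: E; rewrite !H.
Qed.

Lemma mu4_sqnorm f : L2 mu f ->
  sqnorm mu f = 2^-1 *
    (sqnorm mu (f \o @left_branch R) + sqnorm mu (f \o @right_branch R)).
Proof. by move=> /L2P[_ nf]; exact: mu4_Rintegral. Qed.

Lemma nsq_half : nsq (2^-1 : C) = 4^-1.
Proof.
have -> : 2^-1 = (2^-1)%:C :> C by rewrite fmorphV rmorph_nat.
by rewrite /nsq /=; field.
Qed.

(** S_1 f and S_3 f have the same modulus, so the left-hand side integrates half
    of the sum of squares of f at both branches, by the parallelogram law. *)
Lemma sqnorm_fold4 f (P Q : R) : L2 mu f -> P + Q = 1 ->
  sqnorm mu (fold4 0 f) + P * sqnorm mu (fold4 1 f) + Q * sqnorm mu (fold4 3 f)
  = sqnorm mu f.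
Proof.
move=> Lf PQ; have [L0 L1] := L2_comp_branch Lf.
have /L2P[_ i0] := L0; have /L2P[_ i1] := L1.
have E13 : sqnorm mu (fold4 3 f) = sqnorm mu (fold4 1 f).
  apply: eq_Rintegral => x _; rewrite /fold4 !nsqM !nsq_expi !mulr1.
  by congr (_ * nsq (_ + _ * _)); rewrite expr1 -signr_odd.
rewrite E13 -addrA -mulrDl PQ mul1r (mu4_sqnorm Lf).
have sqnormD h k : L2 mu h -> L2 mu k ->
    sqnorm mu h + sqnorm mu k = \int[mu]_x (nsq (h x) + nsq (k x)).
  by move=> /L2P[_ ih] /L2P[_ ik]; rewrite /sqnorm RintegralD.
rewrite (sqnormD _ _ (L2_fold4 0 Lf) (L2_fold4 1 Lf)) (sqnormD _ _ L0 L1).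
rewrite -(RintegralZl _ measurableT (integrableD_EFin i0 i1)).
apply: eq_Rintegral => x _ /=; rewrite /fold4 !nsqM !nsq_expi !mulr1 nsq_half.
have := nsq_parallelogram (f (left_branch x)) (f (right_branch x)).
rewrite expr0 expr1 mul1r mulN1r => H.
by rewrite -mulrDr H; field.
Qed.

End transfer.

(** * The Parseval defect and its limit *)

Section defect.
Local Open Scope classical_set_scope.
Variables (R : realType) (mu : probability (measurableTypeR R) R).
Hypothesis hmu : is_mu4 mu.
Variables (P Q : R).
Hypotheses (P0 : 0 < P) (Q0 : 0 <= Q) (PQ : P + Q = 1).
Local Notation T := (measurableTypeR R).
Local Notation C := R[i].
Implicit Types (f g : R -> C).

(** The part of the squared norm of f that the frequencies n < 4^N miss; it is
    defined by its recursion so that every property is an induction on N. *)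
Fixpoint defect N f : R :=
  if N is N'.+1 then
    defect N' (fold4 0 f) + P * defect N' (fold4 1 f)
      + Q * defect N' (fold4 3 f)
  else cvar mu f.

Lemma defect_ge0 N f : L2 mu f -> 0 <= defect N f.
Proof.
elim: N f => [|N IH] f Lf /=; first exact: cvar_ge0.
by rewrite !addr_ge0// ?mulr_ge0//; first [exact: ltW | apply: IH; exact: L2_fold4].
Qed.

Lemma defect_le_sqnorm N f : L2 mu f -> defect N f <= sqnorm mu f.
Proof.
elim: N f => [|N IH] f Lf /=; first exact: cvar_le.
rewrite -(sqnorm_fold4 hmu Lf PQ); apply: lerD; first apply: lerD.
- by apply: IH; exact: L2_fold4.
- by rewrite (ler_pM2l P0); apply: IH; exact: L2_fold4.
- by rewrite ler_wpM2l//; apply: IH; exact: L2_fold4.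
Qed.

(** The first step only uses that S_0 preserves the integral: frequency 0 is
    kept, and the frequencies 1 and 3 can only lower the defect. *)
Lemma defectS_le N f : L2 mu f -> defect N.+1 f <= defect N f.
Proof.
elim: N f => [|N IH] f Lf.
  rewrite /= /cvar (cintegral_fold4_0 hmu Lf) -(sqnorm_fold4 hmu Lf PQ).
  have := nsq_ge0 (cintegral mu (fold4 1 f)).
  have := nsq_ge0 (cintegral mu (fold4 3 f)).
  move: P0 Q0; nra.
have H d : defect N.+1 (fold4 d f) <= defect N (fold4 d f).
  by apply: IH; exact: L2_fold4.
change (defect N.+1 (fold4 0 f) + P * defect N.+1 (fold4 1 f)
    + Q * defect N.+1 (fold4 3 f) <= defect N (fold4 0 f)
    + P * defect N (fold4 1 f) + Q * defect N (fold4 3 f)).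
apply: lerD; first apply: lerD.
- exact: H.
- by rewrite (ler_pM2l P0); exact: H.
- by rewrite ler_wpM2l//; exact: H.
Qed.

Lemma defectD_le N f g : L2 mu f -> L2 mu g ->
  defect N (fun x => f x + g x) <= 3 * defect N f + 3 / 2 * defect N g.
Proof.
elim: N f g => [|N IH] f g Lf Lg /=; first exact: cvarD_le.
have H d : defect N (fold4 d (fun x => f x + g x)) <=
    3 * defect N (fold4 d f) + 3 / 2 * defect N (fold4 d g).
  have -> : fold4 d (fun x => f x + g x) = (fun x => fold4 d f x + fold4 d g x).
    by apply/funext => x; exact: fold4D.
  by apply: IH; exact: L2_fold4.
have := H 0; have := ler_wpM2l (ltW P0) (H 1); have := ler_wpM2l Q0 (H 3).
lra.
Qed.

Lemma defectM N c f : L2 mu f -> defect N (fun x => c * f x) = nsq c * defect N f.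
Proof.
elim: N f => [|N IH] f Lf /=; first exact: cvarM.
have H d : defect N (fold4 d (fun x => c * f x)) = nsq c * defect N (fold4 d f).
  have -> : fold4 d (fun x => c * f x) = (fun x => c * fold4 d f x).
    by apply/funext => x; exact: fold4Z.
  by apply: IH; exact: L2_fold4.
by rewrite !H; ring.
Qed.

Definition residual f : R := limn (defect ^~ f).

Lemma cvg_defect f : L2 mu f -> defect N f @[N --> \oo] --> residual f.
Proof.
move=> Lf; apply: nonincreasing_is_cvgn.
  by apply/nonincreasing_seqP => N; exact: defectS_le.
by exists 0 => _ [N _ <-]; exact: defect_ge0.
Qed.

Lemma residual_ge0 f : L2 mu f -> 0 <= residual f.
Proof.
move=> Lf; apply: limr_ge.
  by apply/cvg_ex; exists (residual f); exact: cvg_defect.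
by apply: nearW => N; exact: defect_ge0.
Qed.

Lemma residual_le_defect N f : L2 mu f -> residual f <= defect N f.
Proof.
move=> Lf; apply: (@nonincreasing_cvgn_ge _ (defect ^~ f)).
  by apply/nonincreasing_seqP => M; exact: defectS_le.
by apply/cvg_ex; exists (residual f); exact: cvg_defect.
Qed.

Lemma residual_le_sqnorm f : L2 mu f -> residual f <= sqnorm mu f.
Proof.
by move=> Lf; apply: le_trans (residual_le_defect 0 Lf) (defect_le_sqnorm 0 Lf).
Qed.

Lemma residualD_le f g : L2 mu f -> L2 mu g ->
  residual (fun x => f x + g x) <= 3 * residual f + 3 / 2 * residual g.
Proof.
move=> Lf Lg; have Lfg := L2D Lf Lg.
have cR : 3 * defect N f + 3 / 2 * defect N g @[N --> \oo] -->
    3 * residual f + 3 / 2 * residual g.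
  by apply: cvgD; (apply: cvgM; [exact: cvg_cst|exact: cvg_defect]).
apply: (ler_cvg_to (cvg_defect Lfg) cR).
by apply: nearW => N; exact: defectD_le.
Qed.

Lemma residualM c f : L2 mu f -> residual (fun x => c * f x) = nsq c * residual f.
Proof.
move=> Lf; apply/cvg_lim => //.
rewrite (_ : defect ^~ _ = (fun N => nsq c * defect N f)); last first.
  by apply/funext => N; exact: defectM.
by apply: cvgM; [exact: cvg_cst|exact: cvg_defect].
Qed.

Lemma residual_fold4 f : L2 mu f ->
  residual f = residual (fold4 0 f) + P * residual (fold4 1 f)
    + Q * residual (fold4 3 f).
Proof.
move=> Lf; apply/cvg_lim => //; rewrite -(cvg_shiftn 1).
have c d := cvg_defect (L2_fold4 hmu d Lf).
rewrite (_ : (fun n => _) = (fun N => defect N (fold4 0 f)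
  + P * defect N (fold4 1 f) + Q * defect N (fold4 3 f))).
  apply: cvgD; first apply: cvgD.
  - exact: c.
  - by apply: cvgM; [exact: cvg_cst|exact: c].
  - by apply: cvgM; [exact: cvg_cst|exact: c].
by apply/funext => n; rewrite addn1.
Qed.

End defect.

(** * The residual vanishes on exponentials of small frequency *)

Section waves.
Local Open Scope classical_set_scope.
Variables (R : realType) (mu : probability (measurableTypeR R) R).
Hypothesis hmu : is_mu4 mu.
Variables (P Q : R).
Hypotheses (P0 : 0 < P) (Q0 : 0 <= Q) (PQ : P + Q = 1).
Local Notation T := (measurableTypeR R).
Local Notation C := R[i].
Local Notation residual := (residual mu P Q).
Implicit Types (f g : R -> C).

Lemma fold4_wave d t : exists2 m : C, nsq m = (1 + (-1) ^+ d * cos (pi * t)) / 2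
  & fold4 d (wave t) = (fun x => m * wave ((t - d%:R) / 4) x).
Proof.
exists (2^-1 * (1 + (-1) ^+ d * expi (pi * t))).
  rewrite nsqM nsq_half -(signr_odd C) -(signr_odd R); have := cos2Dsin2 (pi * t).
  case: (odd d) => /= H; rewrite ?expr0 ?expr1 ?mul1r ?mulN1r.
    by rewrite /nsq /= sub0r sqrrN -[X in _ + X](addKr (cos (pi * t) ^+ 2)) H; field.
  by rewrite /nsq /= add0r -[X in _ + X](addKr (cos (pi * t) ^+ 2)) H; field.
apply/funext => x; rewrite /fold4 wave_left_branch wave_right_branch.
have -> : (t - d%:R) / 4 = t / 4 + - (d%:R / 4) by field.
by rewrite waveD; ring.
Qed.

Let b t := residual (wave t).

Lemma residual_wave_rec t : b t =
  (1 + cos (pi * t)) / 2 * b (t / 4)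
  + (1 - cos (pi * t)) / 2 * (P * b ((t - 1) / 4) + Q * b ((t - 3) / 4)).
Proof.
rewrite /b (residual_fold4 hmu P0 Q0 PQ (L2_wave mu t)).
have H d : residual (fold4 d (wave t)) =
    (1 + (-1) ^+ d * cos (pi * t)) / 2 * b ((t - d%:R) / 4).
  have [m nm ->] := fold4_wave d t.
  by rewrite (residualM hmu P0 Q0 PQ _ (L2_wave mu _)) nm.
rewrite !H subr0 expr0 expr1 (_ : (-1) ^+ 3 = -1) /b; first by field.
by rewrite -signr_odd.
Qed.

Lemma residual_wave_ge0 t : 0 <= b t.
Proof. by apply: (residual_ge0 hmu) => //; exact: L2_wave. Qed.

Lemma sqnorm_wave t : sqnorm mu (wave t) = 1.
Proof.
rewrite /sqnorm; under eq_Rintegral do rewrite nsq_expi.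
by rewrite Rintegral_cst//= probability_setT mulr1.
Qed.

Lemma residual_wave_le1 t : b t <= 1.
Proof.
apply: le_trans (residual_le_sqnorm hmu P0 Q0 PQ (L2_wave mu t)) _.
by rewrite sqnorm_wave.
Qed.

(** The measure is carried by the interval of centre 1/3 and radius 1/2, so a
    pointwise inequality on that interval can be integrated. *)
Lemma le_Rintegral_near (u v : T -> R) :
  mu.-integrable setT (EFin \o u) -> mu.-integrable setT (EFin \o v) ->
  (forall x : T, `|(x : R) - 3^-1| <= 2^-1 -> u x <= v x) ->
  \int[mu]_x u x <= \int[mu]_x v x.
Proof.
move=> iu iv uv; rewrite /Rintegral.
have mf := measurable_far (2^-1 : R).
rewrite (negligible_integral mf measurableT iu (mu4_far hmu)).
rewrite (negligible_integral mf measurableT iv (mu4_far hmu)).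
apply: le_Rintegral.
- exact: measurableD.
- by apply: integrableS iu => //; exact: measurableD.
- by apply: integrableS iv => //; exact: measurableD.
- move=> x [_ /= /negP]; rewrite -leNgt; exact: uv.
Qed.

(** The residual is at most the variance, which is 1 - |int e_t|^2, and the
    integral of e_t tends to 1 as t tends to 0 because the support is bounded. *)
Lemma residual_wave_near0 (e : R) : 0 < e ->
  exists2 d : R, 0 < d & forall t, `|t| <= d -> b t <= e.
Proof.
move=> e0; have e2 : 0 < e / 2 by rewrite divr_gt0.
have := @continuous_cos R 0; rewrite /continuous_at cos0.
move=> /cvgrPdist_lt /(_ _ e2) /nbhs_ballP[r /= r0 Hr].
exists (r / (4 * pi)); first by rewrite divr_gt0// mulr_gt0// pi_gt0.
move=> t tr; apply: le_trans (residual_le_defect hmu P0 Q0 PQ 0 (L2_wave mu t)) _.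
have near x : `|x - 3^-1| <= 2^-1 -> 1 - e / 2 <= cos (2 * pi * t * x).
  move=> hx; have x1 : `|x| <= 1.
    by move: hx; rewrite !ler_norml => /andP[? ?]; apply/andP; split; lra.
  have : ball (0 : R) r (2 * pi * t * x).
    rewrite /ball /= sub0r normrN !normrM (ger0_norm (ltW (pi_gt0 R))).
    rewrite ger0_norm//; move: tr; rewrite ler_pdivlMr ?mulr_gt0 ?pi_gt0// => tr.
    have : 2 * pi * `|t| * `|x| <= 2 * pi * `|t|.
      by rewrite ler_piMr// !mulr_ge0// ltW// pi_gt0.
    move: r0 tr; lra.
  move=> /Hr /=; rewrite ltr_norml => /andP[_]; lra.
have /L2P[_ iw] := L2_wave mu t.
have [ir _] := L2_cintegrable (L2_wave mu t).
have h : 1 - e / 2 <= complex.Re (cintegral mu (wave t)).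
  rewrite /cintegral /=; apply: le_trans (le_Rintegral_near
    (integrable_cst_EFin mu (1 - e / 2)) ir near).
  by rewrite Rintegral_cst//= probability_setT mulr1.
rewrite /= /cvar.
rewrite sqnorm_wave.
have : 2 * complex.Re (cintegral mu (wave t)) - 1 <= nsq (cintegral mu (wave t)).
  rewrite /nsq; have := sqr_ge0 (complex.Re (cintegral mu (wave t)) - 1).
  by have := sqr_ge0 (complex.Im (cintegral mu (wave t))); lra.
lra.
Qed.

Lemma cos_pi_ge0 (t : R) : `|t| <= 2^-1 -> 0 <= cos (pi * t).
Proof.
rewrite ler_norml => /andP[t1 t2]; apply: cos_ge0_pihalf.
have := pi_gt0 R; move: (pi : R) => k k0.
by apply/andP; split; nra.
Qed.

(** Let c be the supremum of the residuals. The recursion expresses r(e_t) as an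
    average of values at most c, in which a value at most e appears with a weight
    [eta] independent of t; so c <= (1 - eta) c + eta e, that is c <= e. *)
Lemma residual_wave0 t : `|t| <= 1 -> b t = 0.
Proof.
pose S := [set b t | t in [set t : R | `|t| <= 1]].
have S0 : S (b 0) by exists 0 => //=; rewrite normr0.
have supS : has_sup S.
  by split; [exists (b 0)|exists 1 => _ [s _ <-]; exact: residual_wave_le1].
pose c := sup S.
have bc s : `|s| <= 1 -> b s <= c.
  by move=> s1; apply: (ub_le_sup supS.2); exists s.
have P1 : P <= 1 by rewrite -PQ lerDl.
have bPQ s : `|s| <= 1 -> P * b ((s - 1) / 4) + Q * b ((s - 3) / 4) <= c.
  rewrite ler_norml => /andP[s1 s2].
  have h1 : b ((s - 1) / 4) <= c.
    by apply: bc; rewrite ler_norml; apply/andP; split; lra.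
  have h3 : b ((s - 3) / 4) <= c.
    by apply: bc; rewrite ler_norml; apply/andP; split; lra.
  rewrite [leRHS](_ : c = P * c + Q * c); last by rewrite -mulrDl PQ mul1r.
  by apply: lerD; apply: ler_wpM2l => //; exact: ltW.
have cosB s : -1 <= cos (pi * s :> R) <= 1 by rewrite cos_geN1 cos_le1.
(* Near 0 the branch t/4 has weight at least 1/2. *)
have small s : `|s| <= 2^-1 -> b s <= 2^-1 * c + 2^-1 * b (s / 4).
  move=> hs; have s1 : `|s| <= 1 by apply: le_trans hs _; lra.
  have s4 : b (s / 4) <= c.
    apply: bc; move: s1; rewrite !ler_norml => /andP[? ?]; apply/andP; split; lra.
  have Yc := bPQ _ s1; rewrite (residual_wave_rec s); move: Yc.
  set Y := (P * _ + _); move=> Yc.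
  have := cos_pi_ge0 hs; have /andP[_] := cosB s.
  move: (cos _) (b (s / 4)) s4 Y Yc => k X s4 Y Yc k1 k0.
  have : 0 <= k / 2 * (c - X) by rewrite mulr_ge0//; lra.
  have : 0 <= (1 - k) / 2 * (c - Y) by rewrite mulr_ge0//; lra.
  lra.
have iter M s : `|s| <= 2^-1 ->
    b s <= (1 - 2^-1 ^+ M) * c + 2^-1 ^+ M * b (s / 4 ^+ M).
  elim: M s => [|M IH] s hs; first by rewrite !expr0 subrr mul0r add0r mul1r divr1.
  have h4 : `|s / 4| <= 2^-1.
    by move: hs; rewrite !ler_norml => /andP[? ?]; apply/andP; split; lra.
  have -> : s / 4 ^+ M.+1 = s / 4 / 4 ^+ M by rewrite exprS invfM mulrA.
  have := small _ hs; have := IH _ h4; rewrite exprS.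
  move: (_ ^+ M) (b (s / 4 / _)) (b (s / 4)) => a X Y; lra.
(* One of the branches t/4 and (t-1)/4, both landing in [-1/2, 1/2], has weight
   at least P/2, according to the sign of cos (pi t). *)
have step s : `|s| <= 1 -> exists2 r, `|r| <= 2^-1 &
    b s <= (1 - P / 2) * c + P / 2 * b r.
  move=> s1; have Yc := bPQ _ s1.
  have h3 : b ((s - 3) / 4) <= c.
    by apply: bc; move: s1; rewrite !ler_norml => /andP[? ?]; apply/andP; split; lra.
  have h0 : b (s / 4) <= c.
    by apply: bc; move: s1; rewrite !ler_norml => /andP[? ?]; apply/andP; split; lra.
  have h1 : b ((s - 1) / 4) <= c.
    by apply: bc; move: s1; rewrite !ler_norml => /andP[? ?]; apply/andP; split; lra.
  have /andP[k1 k2] := cosB s.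
  have [k0|k0] := lerP 0 (cos (pi * s)).
    exists (s / 4).
      by move: s1; rewrite !ler_norml => /andP[? ?]; apply/andP; split; lra.
    rewrite (residual_wave_rec s); move: Yc k0 k1 k2 h0; move: (cos _) => k.
    set Y := (P * _ + _); move: (b (s / 4)) => X; move: Y => Y Yc k0 k1 k2 h0.
    have : (1 - k) / 2 * Y <= (1 - k) / 2 * c by rewrite ler_wpM2l//; lra.
    have : 0 <= ((1 + k) / 2 - P / 2) * (c - X) by rewrite mulr_ge0//; lra.
    lra.
  exists ((s - 1) / 4).
    by move: s1; rewrite !ler_norml => /andP[? ?]; apply/andP; split; lra.
  rewrite (residual_wave_rec s); move: k0 k1 k2 h0 h1 h3; move: (cos _) => k.
  move: (b (s / 4)) (b ((s - 1) / 4)) (b ((s - 3) / 4)) => X Y Z k0 k1 k2 h0 h1 h3.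
  have : (1 + k) / 2 * X <= (1 + k) / 2 * c by rewrite ler_wpM2l//; lra.
  have : (1 - k) / 2 * (Q * Z) <= (1 - k) / 2 * (Q * c).
    by rewrite ler_wpM2l//; [lra|rewrite ler_wpM2l].
  have : 0 <= P * ((1 - k) / 2 - 2^-1) * (c - Y).
    apply: mulr_ge0; [apply: mulr_ge0; [exact: ltW|]|].
      lra.
    by rewrite subr_ge0.
  have -> : Q = 1 - P by rewrite -PQ; ring.
  lra.
have cle0 : c <= 0.
  apply/ler_addgt0Pr => e e0; rewrite add0r.
  have [d d0 Hd] := residual_wave_near0 e0.
  have [M HM] : exists M, 2^-1 <= d * 4 ^+ M.
    exists (Num.bound (2^-1 / d)); rewrite mulrC -ler_pdivrMr//.
    apply: le_trans (ltW (archi_boundP _)) _; first by rewrite divr_ge0// ltW.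
    by rewrite -natrX ler_nat ltnW// ltn_expl.
  pose eta := P / 2 * 2^-1 ^+ M.
  have eta0 : 0 < eta by rewrite mulr_gt0 ?divr_gt0 ?exprn_gt0.
  have H s : `|s| <= 1 -> b s <= (1 - eta) * c + eta * e.
    move=> s1; have [r hr Hs] := step _ s1; apply: (le_trans Hs).
    have He : b (r / 4 ^+ M) <= e.
      apply: Hd; rewrite normrM normfV [X in _ / X]ger0_norm ?exprn_ge0//.
      by rewrite ler_pdivrMr ?exprn_gt0//; exact: le_trans hr HM.
    have := ler_wpM2l (ltW (divr_gt0 P0 (ltr0n _ 2))) (iter M _ hr).
    have := ler_wpM2l (ltW eta0) He.
    rewrite /eta; lra.
  have : c <= (1 - eta) * c + eta * e.
    by apply: ge_sup; [exists (b 0)|move=> _ [s s1 <-]; exact: H].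
  by move=> ce; rewrite -(ler_pM2l eta0); lra.
move=> t1; apply/eqP; rewrite eq_le residual_wave_ge0 andbT.
exact: le_trans (bc _ t1) cle0.
Qed.

End waves.

(** * The residual vanishes on half-lines *)

Section density.
Local Open Scope classical_set_scope.
Variables (R : realType) (mu : probability (measurableTypeR R) R).
Hypothesis hmu : is_mu4 mu.
Variables (P Q : R).
Hypotheses (P0 : 0 < P) (Q0 : 0 <= Q) (PQ : P + Q = 1).
Local Notation T := (measurableTypeR R).
Local Notation C := R[i].
Local Notation residual := (residual mu P Q).
Implicit Types (f g : R -> C).

Lemma residual_eq0 f : L2 mu f -> residual f <= 0 -> residual f = 0.
Proof.
move=> Lf f0; apply/eqP; rewrite eq_le f0.
by apply: (residual_ge0 hmu) => //; exact: ltW.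
Qed.

Lemma residual_null f : L2 mu f ->
  (forall x, `|x - 3^-1| <= 2^-1 -> f x = 0) -> residual f = 0.
Proof.
move=> Lf f0; apply: residual_eq0 => //.
apply: le_trans (residual_le_sqnorm hmu P0 Q0 PQ Lf) _.
have /L2P[_ nf] := Lf.
have -> : (0 : R) = \int[mu]_x (cst 0 (x : T)).
  by rewrite Rintegral_cst// mul0r.
apply: (le_Rintegral_near hmu nf (integrable_cst_EFin mu 0)) => x hx.
by rewrite f0// nsq0.
Qed.

Definition cindic (A : set R) (x : R) : C := (\1_A x : R)%:C.

Lemma cindicE A x : cindic A x = (x \in A)%:R.
Proof. by rewrite /cindic indicE; case: (x \in A). Qed.

Lemma nsq_cindic_le1 A x : nsq (cindic A x) <= 1.
Proof.
rewrite cindicE; case: (x \in A); last by rewrite nsq0.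
by rewrite /nsq /= expr1n expr0n addr0.
Qed.

Lemma cmeasurable_cindic (A : set T) : measurable A -> cmeasurable (cindic A).
Proof.
by move=> mA; split; [exact: measurable_indic|exact: measurable_cst].
Qed.

Lemma L2_cindic (A : set T) : measurable A -> L2 mu (cindic A).
Proof.
move=> mA; apply: (@L2_bounded _ _ _ 1); first exact: cmeasurable_cindic.
exact: nsq_cindic_le1.
Qed.

Definition ray_wave (a t x : R) : C := cindic `]-oo, a[ x * wave t x.

Lemma L2_ray_wave a t : L2 mu (ray_wave a t).
Proof.
apply: (@L2M_bounded _ _ _ _ 1); last by move=> x; rewrite nsq_expi.
- by apply: L2_cindic; exact: measurable_itv.
- exact: cmeasurable_wave.
Qed.

Lemma ray_wave_ge a t x : a <= x -> ray_wave a t x = 0.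
Proof.
by move=> ax; rewrite /ray_wave cindicE mem_setE in_itv/= ltNge ax mul0r.
Qed.

Lemma ray_wave_lt a t x : x < a -> ray_wave a t x = wave t x.
Proof.
by move=> ax; rewrite /ray_wave cindicE mem_setE in_itv/= ax mul1r.
Qed.

(** Folding preserves the shape of the function because each branch is
    increasing: x/4 < a and (x+2)/4 < a cut at 4a and at 4a - 2. *)
Lemma fold4_ray_wave d a t : exists2 u : C, nsq u = 1 &
  fold4 d (ray_wave a t) = (fun x => 2^-1 *
    (ray_wave (4 * a) ((t - d%:R) / 4) x
     + u * ray_wave (4 * a - 2) ((t - d%:R) / 4) x)).
Proof.
exists ((-1) ^+ d * expi (pi * t)).
  by rewrite nsqM nsq_expi mulr1 nsqX nsqN /nsq/= expr1n expr0n addr0 expr1n.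
apply/funext => x; rewrite /fold4 /ray_wave wave_left_branch wave_right_branch.
have -> : (t - d%:R) / 4 = t / 4 + - (d%:R / 4) by field.
have -> : cindic `]-oo, a[ (left_branch x) = cindic `]-oo, (4 * a)[ x.
  by rewrite !cindicE !mem_setE !in_itv/= /left_branch ltr_pdivrMr// mulrC.
have -> : cindic `]-oo, a[ (right_branch x) = cindic `]-oo, (4 * a - 2)[ x.
  by rewrite !cindicE !mem_setE !in_itv/= /right_branch ltr_pdivrMr// mulrC ltrBrDr.
by rewrite waveD; ring.
Qed.

(** Any threshold between 5/24 and 11/24 separates the two cases: below it the
    cut at 4a - 2 is to the left of the interval of centre 1/3 and radius 1/2 and
    the second summand is null; above it the cut at 4a is to its right and the
    first summand is an exponential up to a null function. *)
Lemma residual_fold4_ray_wave d a t (c : R) : (d <= 3)%N -> `|t| <= 1 ->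
  (forall a' t', `|t'| <= 1 -> residual (ray_wave a' t') <= c) ->
  residual (fold4 d (ray_wave a t)) <= 3 / 8 * c.
Proof.
move=> d3 t1 Hc; have [u nu ->] := fold4_ray_wave d a t.
set s := (t - d%:R) / 4.
have s1 : `|s| <= 1.
  have : d%:R <= 3 :> R by rewrite ler_nat.
  have := ler0n R d.
  by move: t1; rewrite /s !ler_norml => /andP[? ?] ? ?; apply/andP; split; lra.
have Lr a' := L2_ray_wave a' s.
have Lur a' := L2Z u (Lr a').
have c0 : 0 <= c.
  by apply: le_trans (Hc 0 s s1); apply: (residual_ge0 hmu) => //; exact: ltW.
have ru a' : residual (fun x => u * ray_wave a' s x) <= c.
  by rewrite (residualM hmu P0 Q0 PQ _ (Lr a')) nu mul1r; exact: Hc.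
rewrite (residualM hmu P0 Q0 PQ); last exact: L2D.
rewrite nsq_half.
suff : residual (fun x => ray_wave (4 * a) s x + u * ray_wave (4 * a - 2) s x)
    <= 3 / 2 * c by lra.
have [a25|a25] := leP a (2 / 5).
  have -> : (fun x => ray_wave (4 * a) s x + u * ray_wave (4 * a - 2) s x) =
      (fun x => u * ray_wave (4 * a - 2) s x + ray_wave (4 * a) s x).
    by apply/funext => x; rewrite addrC.
  apply: le_trans (residualD_le hmu P0 Q0 PQ (Lur _) (Lr _)) _.
  rewrite (@residual_null (fun x => u * ray_wave (4 * a - 2) s x))//.
    by have := Hc (4 * a) _ s1; lra.
  move=> x; rewrite ler_norml => /andP[x1 x2].
  by rewrite ray_wave_ge ?mulr0//; lra.
apply: le_trans (residualD_le hmu P0 Q0 PQ (Lr _) (Lur _)) _.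
have : residual (ray_wave (4 * a) s) <= 0.
  (* the difference with the full exponential is a null function *)
  have Ld : L2 mu (fun x => ray_wave (4 * a) s x + -1 * wave s x).
    by apply: L2D => //; apply: L2Z; exact: L2_wave.
  have -> : ray_wave (4 * a) s = (fun x => wave s x +
      (ray_wave (4 * a) s x + -1 * wave s x)).
    by apply/funext => x; ring.
  apply: le_trans (residualD_le hmu P0 Q0 PQ (L2_wave _ _) Ld) _.
  rewrite (residual_wave0 hmu P0 Q0 PQ s1) residual_null ?mulr0 ?addr0//.
  move=> x; rewrite ler_norml => /andP[x1 x2].
  by rewrite ray_wave_lt ?mulN1r ?subrr//; lra.
by have := ru (4 * a - 2); lra.
Qed.

(** One folding step multiplies the bound by 3/8 (1 + P + Q) = 3/4. *)
Lemma residual_ray_wave_le k a t : `|t| <= 1 ->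
  residual (ray_wave a t) <= (3 / 4) ^+ k.
Proof.
elim: k a t => [|k IH] a t t1.
  rewrite expr0.
  apply: le_trans (residual_le_sqnorm hmu P0 Q0 PQ (L2_ray_wave a t)) _.
  have /L2P[_ nf] := L2_ray_wave a t.
  have -> : (1 : R) = \int[mu]_x (cst 1 (x : T)).
    by rewrite Rintegral_cst//= probability_setT mulr1.
  apply: (le_Rintegral _ nf (integrable_cst_EFin mu 1)) => // x _.
  by rewrite nsqM nsq_expi mulr1; exact: nsq_cindic_le1.
rewrite (residual_fold4 hmu P0 Q0 PQ (L2_ray_wave a t)).
have H d d3 := @residual_fold4_ray_wave d a t _ d3 t1 IH.
have := H 0 isT; have := ler_wpM2l (ltW P0) (H 1 isT).
have := ler_wpM2l Q0 (H 3 isT); rewrite exprS; move: ((3 / 4) ^+ k) => c.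
have -> : Q = 1 - P by rewrite -PQ; ring.
lra.
Qed.

Lemma residual_ray a : residual (cindic `]-oo, a[) = 0.
Proof.
have -> : cindic `]-oo, a[ = ray_wave a 0.
  by apply/funext => x; rewrite /ray_wave /wave mulr0 mul0r expi0 mulr1.
apply: residual_eq0; first exact: L2_ray_wave.
have c : (3 / 4 : R) ^+ k @[k --> \oo] --> 0.
  by apply: cvg_expr; rewrite ger0_norm; lra.
apply: (ler_cvg_to (cvg_cst (residual (ray_wave a 0))) c).
by apply: nearW => k; apply: residual_ray_wave_le; rewrite normr0.
Qed.

Lemma residual0D f g : L2 mu f -> L2 mu g -> residual f = 0 -> residual g = 0 ->
  residual (fun x => f x + g x) = 0.
Proof.
move=> Lf Lg f0 g0; apply: residual_eq0; first exact: L2D.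
apply: le_trans (residualD_le hmu P0 Q0 PQ Lf Lg) _.
by rewrite f0 g0 !mulr0 addr0.
Qed.

Lemma residual0Z c f : L2 mu f -> residual f = 0 ->
  residual (fun x => c * f x) = 0.
Proof. by move=> Lf f0; rewrite (residualM hmu P0 Q0 PQ _ Lf) f0 mulr0. Qed.

(** By subadditivity r(f) <= 3 r(f - g_n) <= 3 |f - g_n|^2, and dominated
    convergence applies to the last norm. *)
Lemma residual0_closed f (g : nat -> R -> C) (h : R -> R) : L2 mu f ->
  (forall n, L2 mu (g n)) -> (forall n, residual (g n) = 0) ->
  mu.-integrable setT (EFin \o (h : T -> R)) ->
  (forall n x, nsq (f x + -1 * g n x) <= h x) ->
  (forall x, nsq (f x + -1 * g n x) @[n --> \oo] --> (0 : R)) ->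
  residual f = 0.
Proof.
move=> Lf Lg g0 ih dom cv; apply: residual_eq0 => //.
have Ld n : L2 mu (fun x => f x + -1 * g n x) by apply: L2D => //; exact: L2Z.
have md n : measurable_fun setT ((fun x => nsq (f x + -1 * g n x)) : T -> R).
  by have /L2P[/measurable_nsq] := Ld n.
have le n : residual f <= 3 * sqnorm mu (fun x => f x + -1 * g n x).
  have {1}-> : f = (fun x => (f x + -1 * g n x) + g n x).
    by apply/funext => x; ring.
  apply: le_trans (residualD_le hmu P0 Q0 PQ (Ld n) (Lg n)) _.
  rewrite g0 mulr0 addr0 ler_pM2l//.
  exact: (residual_le_sqnorm hmu P0 Q0 PQ (Ld n)).
have [|||||_ _ cI] := @dominated_convergence _ T R mu setT measurableT
  (fun n x => (nsq (f x + -1 * g n x))%:E) (cst 0%E) (EFin \o (h : T -> R)).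
- by move=> n; apply/measurable_EFinP.
- exact: measurable_cst.
- by apply: aeW => x _; apply: cvg_EFin; [exact: nearW|exact: cv].
- exact: ih.
- by apply: aeW => x n _; rewrite abse_EFin ger0_norm ?nsq_ge0// lee_fin.
have c0 : 3 * sqnorm mu (fun x => f x + -1 * g n x) @[n --> \oo] --> (3 * 0 : R).
  apply: cvgM; first exact: cvg_cst.
  by move: cI; rewrite integral0 => /fine_cvg.
rewrite mulr0 in c0.
by apply: (ler_cvg_to (cvg_cst (residual f)) c0); apply: nearW.
Qed.

End density.

(** * The residual vanishes everywhere *)

Section completeness.
Local Open Scope classical_set_scope.
Variables (R : realType) (mu : probability (measurableTypeR R) R).
Hypothesis hmu : is_mu4 mu.
Variables (P Q : R).
Hypotheses (P0 : 0 < P) (Q0 : 0 <= Q) (PQ : P + Q = 1).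
Local Notation T := (measurableTypeR R).
Local Notation C := R[i].
Local Notation residual := (residual mu P Q).
Implicit Types (f g : R -> C).

Lemma residual_setC (A : set T) : measurable A -> residual (cindic A) = 0 ->
  residual (cindic (~` A)) = 0.
Proof.
move=> mA A0.
have -> : cindic (~` A) = (fun x => wave 0 x + -1 * cindic A x).
  apply/funext => x; rewrite /wave mulr0 mul0r expi0 !cindicE in_setC.
  by case: (x \in A) => /=; rewrite ?mulr1 ?subrr// mulr0 addr0.
apply: (residual0D hmu P0 Q0 PQ).
- exact: L2_wave.
- by apply: L2Z; exact: L2_cindic.
- by apply: (residual_wave0 hmu P0 Q0 PQ); rewrite normr0.
- by apply: (residual0Z hmu P0 Q0 PQ) => //; exact: L2_cindic.
Qed.

Lemma residual_sum (I : Type) (r : seq I) (g : I -> R -> C) :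
  (forall i, L2 mu (g i)) -> (forall i, residual (g i) = 0) ->
  L2 mu (fun x => \sum_(i <- r) g i x) /\
  residual (fun x => \sum_(i <- r) g i x) = 0.
Proof.
move=> Lg g0; elim: r => [|i r [LS S0]].
  have -> : (fun x => \sum_(i <- [::]) g i x) = (fun x => 0 * wave 0 x).
    by apply/funext => x; rewrite big_nil mul0r.
  split; first by apply: L2Z; exact: L2_wave.
  by rewrite (residualM hmu P0 Q0 PQ _ (L2_wave mu 0)) nsq0 mul0r.
have -> : (fun x => \sum_(j <- i :: r) g j x) = 
    (fun x => g i x + \sum_(j <- r) g j x).
  by apply/funext => x; rewrite big_cons.
by split; [exact: L2D|exact: (residual0D hmu P0 Q0 PQ)].
Qed.

Lemma residual_bigcup (F : (set T)^nat) : (forall n, measurable (F n)) ->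
  trivIset setT F -> (forall n, residual (cindic (F n)) = 0) ->
  residual (cindic (\bigcup_n F n)) = 0.
Proof.
move=> mF tF F0; pose S n x := \sum_(i <- iota 0 n) cindic (F i) x.
have LF i := L2_cindic mu (mF i).
have SE n x : S n x = cindic (\big[setU/set0]_(i < n) F i) x.
  rewrite -(bigcup_mkord n F) /S.
  elim: n => [|n IH].
    by rewrite /= big_nil bigcup_mkord big_ord0 cindicE in_set0.
  rewrite -addn1 iotaD big_cat /= big_seq1 [X in X + _]IH add0n.
  rewrite !bigcup_mkord addn1 big_ord_recr /= !cindicE in_setU.
  case: (boolP (x \in F n)) => xn; last by rewrite orbF addr0.
  rewrite orbT [x \in _](_ : _ = false) ?add0r//.
  apply/negbTE/negP; rewrite inE -bigcup_mkord => -[i /= ni xi].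
  move/trivIsetP : tF => /(_ i n Logic.I Logic.I).
  rewrite neq_ltn ni => /(_ isT) E.
  have : (F i `&` F n) x by split => //; exact: set_mem.
  by rewrite E.
apply: (@residual0_closed _ _ hmu _ _ P0 Q0 PQ _ S (cst 1)).
- by apply: L2_cindic; exact: bigcupT_measurable.
- by move=> n; have [] := residual_sum (iota 0 n) LF F0.
- by move=> n; have [] := residual_sum (iota 0 n) LF F0.
- exact: integrable_cst_EFin.
- move=> n x; rewrite SE !cindicE.
  case: (_ \in _); case: (_ \in _); rewrite ?mulN1r ?subrr ?add0r ?oppr0 ?addr0
    ?nsqN ?nsq0// /nsq /= expr1n expr0n addr0//.
- move=> x; apply: cvg_near_cst; have [[k _ xk]|nx] := pselect ((\bigcup_n F n) x).
    near=> n; rewrite SE !cindicE !mem_set ?mulN1r ?subrr ?nsq0//.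
      rewrite -bigcup_mkord; exists k => //=.
      by near: n; exact: nbhs_infty_gt.
    by exists k.
  apply: nearW => n; rewrite SE !cindicE !memNset ?mulr0 ?addr0 ?nsq0//.
  by rewrite -bigcup_mkord => -[i _ xi]; apply: nx; exists i.
Unshelve. all: by end_near. Qed.

(** Dynkin's theorem: the sets whose indicator has residual 0 are stable under
    complements and countable disjoint unions. *)
Lemma residual_cindic (A : set T) : measurable A -> residual (cindic A) = 0.
Proof.
move=> mA.
apply: (@dynkin_induction _ T (@RGenInftyO.G R) (fun A => residual (cindic A) = 0)).
- exact: RGenInftyO.measurableE.
- move=> _ _ [x ->] [y ->]; exists (Num.min x y).
  by apply/seteqP; split => z /=; rewrite !in_itv/= lt_min => /andP.
- have -> : cindic [set: T] = wave (0 : R).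
    by apply/funext => x; rewrite cindicE in_setT /wave mulr0 mul0r expi0.
  by apply: (residual_wave0 hmu P0 Q0 PQ); rewrite normr0.
- by move=> _ [a ->]; exact: (residual_ray hmu P0 Q0 PQ).
- by move=> S mS; exact: residual_setC.
- exact: residual_bigcup.
- change ((RGenInftyO.G (R:=R)).-sigma.-measurable A).
  by rewrite -RGenInftyO.measurableE.
Qed.

Import HBNNSimple.

Lemma residual_nnsfun (s : {nnsfun T >-> R}) :
  L2 mu (fun x => (s x)%:C) /\ residual (fun x => (s x)%:C) = 0.
Proof.
have [r sE] : exists r : seq R, forall x,
    (s x)%:C = \sum_(y <- r) (y%:C * cindic (s @^-1` [set y]) x).
  exists (finmap.enum_fset (fset_set (range s))) => x.
  rewrite {1}(fimfunE s x) fsbig_finite//= rmorph_sum.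
  by apply: eq_bigr => y _; rewrite rmorphM.
have -> : (fun x => (s x)%:C) = _ := funext sE.
have mS y : measurable (s @^-1` [set y]) by exact: measurable_sfunP.
apply: residual_sum.
- by move=> y; apply: L2Z; exact: L2_cindic.
- move=> y; apply: (residual0Z hmu P0 Q0 PQ); first exact: L2_cindic.
  exact: residual_cindic.
Qed.

Lemma residual_nneg (u : T -> R) : (forall x, 0 <= u x) ->
  L2 mu (fun x => (u x)%:C) -> residual (fun x => (u x)%:C) = 0.
Proof.
move=> u0 Lu; have /L2P[[mu_ _] nu] := Lu.
have mE : measurable_fun setT (EFin \o u) by exact/measurable_EFinP.
pose s := nnsfun_approx measurableT mE.
have sE n (x : T) : nsq ((u x)%:C + -1 * (s n x)%:C) = (u x - s n x) ^+ 2.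
  by rewrite /nsq /=; ring.
have cs (x : T) : s n x @[n --> \oo] --> u x.
  have /fine_cvg := @cvg_nnsfun_approx _ _ _ _ measurableT _ mE
    (fun x _ => u0 x) x Logic.I.
  exact.
have su n (x : T) : s n x <= u x.
  rewrite -lee_fin /s nnsfun_approxE.
  by apply: le_approx => // y _; rewrite lee_fin.
apply: (@residual0_closed _ _ hmu _ _ P0 Q0 PQ _ (fun n x => (s n x)%:C)
  (fun x => nsq (u x)%:C) Lu).
- by move=> n; have [] := residual_nnsfun (s n).
- by move=> n; have [] := residual_nnsfun (s n).
- exact: nu.
- move=> n x; rewrite sE /nsq /= expr0n addr0.
  have s0 : 0 <= s n x by [].
  by have := su n x; have := u0 x; nra.
- move=> x; rewrite (_ : (fun n => _) = (fun n => (u x - s n x) ^+ 2)).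
    have c0 : u x - s n x @[n --> \oo] --> (0 : R).
      by rewrite -(subrr (u x)); apply: cvgB; [exact: cvg_cst|exact: cs].
    by rewrite -(mulr0 (0 : R)); exact: cvgM.
  by apply/funext => n; exact: sE.
Qed.

Lemma residual_real (u : T -> R) :
  L2 mu (fun x => (u x)%:C) -> residual (fun x => (u x)%:C) = 0.
Proof.
move=> Lu; have /L2P[[mu_ _] nu] := Lu.
have ip : L2 mu (fun x => (u^\+ x)%:C).
  apply: (@le_L2 _ _ _ (fun x => nsq (u x)%:C)) => //.
    split; last exact: measurable_cst.
    exact: measurable_funrpos.
  move=> x; rewrite /nsq /= expr0n !addr0 /funrpos.
  by case: (leP (u x) 0) => // _; rewrite expr0n sqr_ge0.
have in_ : L2 mu (fun x => (u^\- x)%:C).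
  apply: (@le_L2 _ _ _ (fun x => nsq (u x)%:C)) => //.
    split; last exact: measurable_cst.
    exact: measurable_funrneg.
  move=> x; rewrite /nsq /= expr0n !addr0 /funrneg.
  by case: (leP (- u x) 0) => // _; rewrite ?expr0n ?sqr_ge0 ?sqrrN.
have -> : (fun x => (u x)%:C) = (fun x => (u^\+ x)%:C + -1 * (u^\- x)%:C).
  apply/funext => x; rewrite mulN1r -rmorphB; congr (_%:C).
  by rewrite -[u in LHS]funrposBneg.
apply: (residual0D hmu P0 Q0 PQ) => //; first exact: L2Z.
  by apply: residual_nneg => // x; exact: funrpos_ge0.
apply: (residual0Z hmu P0 Q0 PQ) => //.
by apply: residual_nneg => // x; exact: funrneg_ge0.
Qed.

Lemma residual_L2 f : L2 mu f -> residual f = 0.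
Proof.
move=> Lf; have /L2P[[mr mi] nf] := Lf.
have Lr : L2 mu (fun x => (complex.Re (f x))%:C).
  apply: (@le_L2 _ _ _ (fun x => nsq (f x))) => //.
  move=> x; case: (f x) => a b; rewrite /nsq /= expr0n addr0.
  by rewrite lerDl sqr_ge0.
have Li : L2 mu (fun x => (complex.Im (f x))%:C).
  apply: (@le_L2 _ _ _ (fun x => nsq (f x))) => //.
  move=> x; case: (f x) => a b; rewrite /nsq /= expr0n addr0.
  by rewrite lerDr sqr_ge0.
have -> : f = (fun x => (complex.Re (f x))%:C + (0 +i* 1) * (complex.Im (f x))%:C).
  apply/funext => x; case: (f x) => a b; apply/eqP; rewrite eq_complex /=.
  by apply/andP; split; apply/eqP; ring.
apply: (residual0D hmu P0 Q0 PQ) => //; first exact: L2Z.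
  exact: residual_real.
by apply: (residual0Z hmu P0 Q0 PQ) => //; exact: residual_real.
Qed.

End completeness.

(** * Base 4 digits and the Parseval identity *)

(** All digits of n at positions beyond n are 0, hence differ from k; choosing
    the same bound for 4 k + d and k gives the recursion on the last digit. *)
Lemma ldigitE k n M : (0 < k)%N -> (n <= M)%N ->
  ldigit k n = (\sum_(j < M) ((n %/ 4 ^ j) %% 4 == k))%N.
Proof.
move=> k0 /subnK <-; rewrite addnC big_split_ord /=.
rewrite [X in (_ + X)%N]big1 ?addn0// => j _.
rewrite divn_small ?mod0n; first by case: k k0.
apply: leq_trans (_ : 4 ^ n <= _)%N; first exact: ltn_expl.
by rewrite leq_exp2l// leq_addr.
Qed.

Lemma ldigit_rec j k d : (0 < j)%N -> (d < 4)%N ->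
  ldigit j (4 * k + d) = ((d == j) + ldigit j k)%N.
Proof.
move=> j0 d4; rewrite (@ldigitE _ _ (4 * k + d).+1)// big_ord_recl.
rewrite expn0 divn1 mulnC modnMDl modn_small//; congr (_ + _)%N.
rewrite (@ldigitE _ k (k * 4 + d))//; last first.
  by rewrite (leq_trans _ (leq_addr _ _))// leq_pmulr.
apply: eq_bigr => i _ /=.
by rewrite /bump /= add1n expnS divnMA divnMDl// (divn_small d4) addn0.
Qed.

Section digit_weight.
Variables (R : realType) (p q : R[i]).

Definition digit_weight (n : nat) : R[i] :=
  p ^+ ldigit 1 n * 0 ^+ ldigit 2 n * q ^+ ldigit 3 n.

Lemma digit_weight_rec k d : (d < 4)%N ->
  digit_weight (4 * k + d) = nth 0 [:: 1; p; 0; q] d * digit_weight k.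
Proof.
move=> d4; rewrite /digit_weight !ldigit_rec//.
by case: d d4 => [|[|[|[|//]]]] _ /=; rewrite ?add0n ?add1n ?exprS; ring.
Qed.

Lemma digit_weight0 : digit_weight 0 = 1.
Proof. by rewrite /digit_weight /ldigit !big_ord0 !expr0 !mulr1. Qed.

End digit_weight.

Lemma sum_base4 (V : zmodType) (F : nat -> V) m :
  \sum_(n < 4 * m) F n =
  \sum_(k < m)
    (F (4 * k + 0)%N + F (4 * k + 1)%N + F (4 * k + 2)%N + F (4 * k + 3)%N).
Proof.
elim: m => [|m IH]; first by rewrite muln0 !big_ord0.
rewrite [RHS]big_ord_recr -IH mulnS addnC /= !addnS addn0.
by rewrite !big_ord_recr /= !addrA.
Qed.

Section parseval.
Variables (R : realType) (mu : probability (measurableTypeR R) R).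
Hypothesis hmu : is_mu4 mu.
Variables (p q : R[i]).
Hypothesis pq : nsq p + nsq q = 1.
Local Notation defect := (defect mu (nsq p) (nsq q)).

(** The defect recursion is the splitting of n < 4^(N+1) according to the last
    digit of n. *)
Lemma defectE N f : L2 mu f ->
  defect N f = sqnorm mu f -
    \sum_(n < 4 ^ N) nsq (digit_weight p q n) * nsq (coef mu f n%:R).
Proof.
elim: N f => [|N IH] f Lf.
  rewrite expn0 big_ord1 digit_weight0 /= /cvar.
  have -> : nsq (1 : R[i]) = 1 by rewrite /nsq /= expr1n expr0n addr0.
  rewrite mul1r /coef /L2inner; congr (_ - nsq (cintegral mu _)).
  by apply/funext => x; rewrite conj_wave /wave oppr0 mulr0 mul0r expi0 mulr1.
have L d := L2_fold4 hmu d Lf.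
rewrite /= !IH// -(sqnorm_fold4 hmu Lf pq) expnS.
rewrite (sum_base4 (fun n => nsq (digit_weight p q n) * nsq (coef mu f n%:R))).
rewrite [in RHS](eq_bigr (fun k : 'I_(4 ^ N) =>
   nsq (digit_weight p q k) * nsq (coef mu (fold4 0 f) k%:R)
   + nsq p * (nsq (digit_weight p q k) * nsq (coef mu (fold4 1 f) k%:R))
   + nsq q * (nsq (digit_weight p q k) * nsq (coef mu (fold4 3 f) k%:R)))).
  rewrite !big_split -!mulr_sumr /=; ring.
move=> k _; rewrite !digit_weight_rec// !nsqM !(coef_fold4 hmu)// nsq0.
have -> : nsq (1 : R[i]) = 1 by rewrite /nsq /= expr1n expr0n addr0.
by ring.
Qed.

End parseval.

Theorem theorem3 (R : realType) (mu : probability (measurableTypeR R) R)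
    (hmu : is_mu4 mu) (p q : R[i]) (hpq : `|p| ^+ 2 + `|q| ^+ 2 = 1)
    (hp : p <> 0) :
  L2parseval_frame mu (fun (n : nat) (x : R) =>
    p ^+ ldigit 1 n * 0 ^+ ldigit 2 n * q ^+ ldigit 3 n
      * expi (2 * pi * n%:R * x)).
Proof.
have pq : nsq p + nsq q = 1.
  by move: hpq; rewrite -!add_Re2_Im2 -rmorphD => /complexI.
have P0 : 0 < nsq p.
  rewrite lt_neqAle nsq_ge0 andbT eq_sym; apply/eqP => p0; apply: hp.
  apply: ComplexField.Normc.eq0_normc; apply/eqP.
  by rewrite -(sqrf_eq0 (ComplexField.Normc.normc p)) nsqE p0.
have Q0 := nsq_ge0 q.
split=> [n|v Lv]; first by apply: L2Z; exact: L2_wave.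
pose a n := nsq (digit_weight p q n) * nsq (coef mu v n%:R).
have aE n : (ComplexField.Normc.normc (L2inner mu v (fun x =>
    p ^+ ldigit 1 n * 0 ^+ ldigit 2 n * q ^+ ldigit 3 n
      * expi (2 * pi * n%:R * x)))) ^+ 2 = a n.
  rewrite nsqE /a -(nsq_conj (digit_weight p q n)) -nsqM /coef /L2inner.
  rewrite -cintegralZ; last exact: (L2_cintegrable (L2_mul_wave _ Lv)).
  congr (nsq (cintegral mu _)); apply/funext => x.
  by rewrite rmorphM /= mulrCA.
have a0 n : 0 <= a n by rewrite mulr_ge0// nsq_ge0.
have dE N := @defectE _ _ hmu _ _ pq N v Lv.
have r0 := residual_L2 hmu P0 Q0 pq Lv.
(* The partial sums increase, and those over n < 4^N tend to the squared norm
   because the residual is 0. *)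
pose S N := \sum_(0 <= n < N) a n.
have ndS : nondecreasing_seq S.
  by apply/nondecreasing_seqP => N; rewrite /S big_nat_recr//= lerDl.
have SE N : S (4 ^ N)%N = sqnorm mu v - defect mu (nsq p) (nsq q) N v.
  by rewrite dE opprB addrC subrK /S big_mkord.
have Sle N : S N <= sqnorm mu v.
  apply: le_trans (ndS N (4 ^ N)%N _) _; first by apply: ltnW; exact: ltn_expl.
  by rewrite SE gerBl; apply: (defect_ge0 hmu) => //; exact: ltW.
have cS : cvgn S.
  by apply: nondecreasing_is_cvgn => //; exists (sqnorm mu v) => _ [N _ <-].
have SL : limn S = sqnorm mu v.
  apply/eqP; rewrite eq_le; apply/andP; split.
    by apply: limr_le => //; exact: nearW.
  have cD := cvg_defect hmu P0 Q0 pq Lv; rewrite r0 in cD.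
  have cB : (sqnorm mu v - defect mu (nsq p) (nsq q) N v @[N --> \oo]
      --> sqnorm mu v - 0)%classic.
    by apply: cvgB => //; exact: cvg_cst.
  rewrite subr0 in cB.
  apply: (ler_cvg_to cB (cvg_cst (limn S))); apply: nearW => N.
  by rewrite -SE; exact: nondecreasing_cvgn_le.
rewrite sqnorm_L2norm -SL; apply/cvg_lim => //.
rewrite (_ : (fun n => _) = EFin \o S); last first.
  by apply/funext => N /=; rewrite /S -sumEFin; apply: eq_bigr => n _; rewrite aE.
by apply: cvg_EFin; [exact: nearW|exact: cS].
Qed.
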